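(* Let $p$ be a prime, $e\ge1$ an integer, $q=p^e$, and let $n,m$ be positive integers both dividing $q+1$. Let $\tilde n=\frac{q+1}{n}$ and $\tilde m=\frac{q+1}{m}$, and let $\mathcal{F}_{n,m}=\mathbb{F}_{q^2}(U,V)$ with $U^n+V^m+1=0$, with Cartier operator $\mathcal{C}$. For positive integers $i,j$ put $$\omega_{i,j}=\frac{U^iV^j}{U\,V\,mV^{m-1}}\,dU.$$ Then for all positive integers $i,j$ with $mi+nj<mn$, we have $\mathcal{C}(\omega_{i,j})=0$ exactly when $i\not\equiv0\pmod p$, $j\not\equiv 0\pmod p$ and $(\tilde n i\bmod p)+(\tilde m j\bmod p)\le p$. Otherwise, $$\mathcal{C}(\omega_{i,j})=(-1)^{\left\lceil\frac{jp^{e-1}}{m}\right\rceil+\tilde m j}\binom{(\tilde m j-1)\bmod p}{(p-\tilde n i)\bmod p}\,\omega_{\tilde{\imath},\tilde{\jmath}},$$ where $\tilde{\imath}=n\left\lceil\frac{ip^{e-1}}{n}\right\rceil-ip^{e-1}$ and $\tilde{\jmath}=m\left\lceil\frac{jp^{e-1}}{m}\right\rceil-jp^{e-1}$.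
   Context: For integers $a$ and $b\geq 1$, $a \bmod b$ denotes the residue of $a$ in $\{0,1,\dots,b-1\}$. Cartier operator: let $F/K$ be a function field over a perfect field $K$ of characteristic $p>0$ and let $t$ be a separating element. Every differential $\omega$ of $F/K$ can be written uniquely as $\omega=(x_0^p+x_1^pt+\cdots+x_{p-1}^pt^{p-1})\,dt$ with $x_i\in F$, and $\mathcal{C}(\omega):=x_{p-1}\,dt$; this does not depend on $t$. The $\omega_{i,j}$ with $i,j\geq1$ and $mi+nj<mn$ form a basis of the space of holomorphic differentials of $\mathcal{F}_{n,m}$. The condition that $n$ and $m$ divide $q+1$ is equivalent to $\mathcal{F}_{n,m}$ being $\mathbb{F}_{q^2}$-maximal. *)

(* Defs.v *)
From HB Require Import structures.
From mathcomp Require Import all_boot all_order all_algebra all_field.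
From mathcomp Require Import classical_sets.

Set Implicit Arguments.
Unset Strict Implicit.
Unset Printing Implicit Defensive.

Import GRing.Theory.
Local Open Scope ring_scope.

Local Notation "x %:F" := (tofrac x) : ring_scope.

(* A function field F/K is given as a finite extension of the rational        *)
(* function field K(x) = {fraction {poly K}}.                                 *)
Section FunctionField.

Variables (K : fieldType) (F : fieldExtType {fraction {poly K}}).

Definition const (c : K) : F := (c%:P%:F)%:A.

HB.instance Definition _ := GRing.RMorphism.copy const
  (in_alg F \o @tofrac _ \o @polyC K).

Definition ratvar : F := ('X%:F)%:A.

Definition peval (t : F) (a : {poly K}) : F := (map_poly const a).[t].

(* membership in K(t) *)
Definition in_adjoin (t y : F) : Prop :=
  exists a b : {poly K}, peval t b != 0 /\ y = peval t a / peval t b.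

(* t is separating: F / K(t) is (algebraic and) separable.                    *)
Definition separating (t : F) : Prop :=
  forall x : F, exists P : {poly F},
    [/\ forall i, in_adjoin t P`_i, separable_poly P & root P x].

Definition is_derivation (M : lmodType F) (D : F -> M) : Prop :=
  [/\ forall x y, D (x + y) = D x + D y,
      forall x y, D (x * y) = x *: D y + y *: D x
    & forall c, D (const c) = 0].

(* (Omega, d) is the module of differentials of F/K, with its universal       *)
(* K-derivation d.                                                            *)
Definition is_differentials (Omega : lmodType F) (d : F -> Omega) : Prop :=
  is_derivation d /\
  forall (M : lmodType F) (D : F -> M), is_derivation D ->
    exists2 f : {linear Omega -> M}, (forall x, D x = f (d x))
      & forall g : {linear Omega -> M}, (forall x, D x = g (d x)) -> g =1 f.

Variables (p : nat) (Omega : lmodType F) (d : F -> Omega).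

Definition cartier_image (w v : Omega) : Prop :=
  exists (t : F) (x : nat -> F),
    [/\ separating t,
        w = (\sum_(i < p) x i ^+ p * t ^+ i) *: d t
      & v = x p.-1 *: d t].

(* When K is perfect of characteristic p, each w has exactly one image, which *)
(* does not depend on the separating element used to compute it.              *)
Definition cartier (w : Omega) : Omega :=
  xget 0 [set v | cartier_image w v]%classic.

End FunctionField.

Arguments const {K} F c.
Arguments ratvar {K} F.

(* The ceiling of a / b, for b > 0. Since a <= b * ceil_div a b, the truncated *)
(* difference b * ceil_div a b - a is the exact one.                          *)
Definition ceil_div (a b : nat) : nat := ((a + b.-1) %/ b)%N.

(* the residue of an integer a in {0, ..., b - 1} *)
Definition residue (a : int) (b : nat) : nat := `|(a %% b)%Z|%N.

Definition omega (K : fieldType) (F : fieldExtType {fraction {poly K}})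
    (Omega : lmodType F) (d : F -> Omega) (m : nat) (U V : F) (i j : nat) :
    Omega :=
  (U ^+ i * V ^+ j / (U * V * (m%:R * V ^+ m.-1))) *: d U.

(* Main.v *)
Require Import Defs.
From HB Require Import structures.
From mathcomp Require Import all_boot all_order all_algebra all_field.
From mathcomp Require Import classical_sets ring zify.

(* Write U for the rational variable. The map sending sum_i c_i X^i to          *)
(* sum_i c_i^p U^i is a surjective ring morphism F[X] -> F: its image contains  *)
(* K, U and V = V^(q+1) / V^q, where V^(q+1) = (- (1 + U^n))^mt. Its kernel is  *)
(* generated by the polynomial X^p - U, which is irreducible because F is       *)
(* separable over K(U), so that U is not a p-th power. Hence the derivation     *)
(* d/dU is induced by the formal derivative, and the Cartier operator by        *)
(* P |-> the coefficient of X^(p-1) in P mod (X^p - U). Any other separating t  *)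
(* gives the same operator because f^(p-1) df is mapped to df.                  *)
(*   With a = (mt j - 1) mod p one has V^(j - m) = (V^b)^p (- (1 + U^n))^a for  *)
(* an integer b, and in the binomial expansion the operator keeps the single    *)
(* term U^(i + n k - 1) with p | i + n k, that is, k = - nt i mod p. It         *)
(* vanishes exactly when k > a.                                                 *)

Set Implicit Arguments.
Unset Strict Implicit.
Unset Printing Implicit Defensive.

Import GRing.Theory.
Local Open Scope ring_scope.

(** Once the operator is known to read off the coordinate on U^(p-1) ([cartier_frob_coef]),
    [frob_coef_omega] leaves a single binomial term, and the rest is arithmetic. Since n nt = m mt =
    p p^(e-1) + 1, the ceilings in [it] and [jt] are those of nt i / p and mt j / p
    ([ceil_div_bounds]). With k and b the residues of - nt i and - mt j modulo p, this gives a = p -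
    1 - b, p it = i + n k and p jt = j + m b, so the result is (-1)^a binom(a, k) omega_{it,jt}. It
    vanishes exactly when a < k, that is k + b >= p, which [modn_sum_from_multiples] rewrites as the
    stated condition. The sign follows from the parity of b + mt j, a multiple of p. *)

(** * Derivation and Cartier operator via polynomials modulo X^p - u *)

Section FrobeniusEval.

Variables (p : nat) (F : fieldType) (pcharF : p \in [pchar F]) (u : F).

Definition frob_eval (P : {poly F}) : F :=
  (map_poly (pFrobenius_aut pcharF) P).[u].

HB.instance Definition _ := GRing.RMorphism.copy frob_eval
  (horner_eval u \o map_poly (pFrobenius_aut pcharF)).

Lemma frob_evalC c : frob_eval c%:P = c ^+ p.
Proof. by rewrite /frob_eval map_polyC hornerC. Qed.

Lemma frob_evalX : frob_eval 'X = u.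
Proof. by rewrite /frob_eval map_polyX hornerX. Qed.

Lemma frob_evalZ c P : frob_eval (c *: P) = c ^+ p * frob_eval P.
Proof. by rewrite -mul_polyC rmorphM /= frob_evalC. Qed.

Lemma frob_evalE (P : {poly F}) n : (size P <= n)%N ->
  frob_eval P = \sum_(i < n) P`_i ^+ p * u ^+ i.
Proof.
move=> leP; rewrite /frob_eval (@horner_coef_wide _ n) ?size_map_poly //.
by apply: eq_bigr => i _; rewrite coef_map.
Qed.

(** Closes the image under inverses: f^-1 = f^(p-1) (f^-1)^p, and the last factor is the value of a
    constant. *)
Lemma frob_eval_inv f P : frob_eval P = f ->
  frob_eval (P ^+ p.-1 * (f^-1)%:P) = f^-1.
Proof.
move=> defP; rewrite rmorphM rmorphXn /= defP frob_evalC.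
have p_gt0 : (0 < p)%N by case/andP: pcharF => /prime_gt0.
have [->|nzf] := eqVneq f 0.
  by rewrite invr0 [0 ^+ p]expr0n -[p]prednK //= mulr0.
by rewrite -{2}(prednK p_gt0) exprS mulrCA exprVn divff ?mulr1 ?expf_neq0.
Qed.

Let p_pr : prime p. Proof. by case/andP: pcharF. Qed.

Hypothesis u_npow : forall y, y ^+ p != u.

Local Notation Q := ('X^p - u%:P).

Lemma size_Xp_sub : size Q = p.+1.
Proof. by rewrite size_XnsubC ?prime_gt0. Qed.

Lemma frob_eval_Xp_sub : frob_eval Q = 0.
Proof. by rewrite rmorphB rmorphXn /= frob_evalX frob_evalC subrr. Qed.

Lemma deriv_Xp_sub : Q^`() = 0.
Proof.
rewrite derivB derivC subr0 derivXn -mulr_natr -polyC_natr (pcharf0 pcharF).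
by rewrite mulr0.
Qed.

(* Over F^p the polynomial Q becomes (X - u)^p, so a monic factor of degree r *)
(* becomes (X - u)^r, whose subleading coefficient -r u determines u up to the *)
(* p-th power r = r^p.                                                        *)
Lemma irredp_Xp_sub : irreducible_poly Q.
Proof.
split; first by rewrite size_Xp_sub ltnS prime_gt0.
move=> G G1 dvdG.
pose g := map_poly (pFrobenius_aut pcharF).
have gQ : g Q = ('X - u%:P) ^+ p.
  rewrite /g rmorphB /= map_polyXn map_polyC.
  have pP : p \in [pchar {poly F}] by apply: (rmorph_pchar polyC).
  rewrite -[RHS](pFrobenius_autE pP) rmorphB /= !pFrobenius_autE.
  by rewrite -polyC_exp.
have nzQ : Q != 0 by rewrite -size_poly_eq0 size_Xp_sub.
have nzG : G != 0 by apply: contraNneq nzQ => G0; rewrite G0 dvd0p in dvdG.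
have : g G %| ('X - u%:P) ^+ p by rewrite -gQ dvdp_map.
case/dvdp_exp_XsubCP => r le_rp eqG.
have szG : size G = r.+1.
  rewrite -(size_map_poly (pFrobenius_aut pcharF)) (eqp_size eqG).
  exact: size_exp_XsubC.
have [defr|ne_rp] := eqVneq r p.
  by rewrite -dvdp_size_eqp // szG size_Xp_sub defr.
have r_gt0 : (0 < r)%N by case: (r) szG G1 => // ->.
case/eqpP: eqG => -[a b] /= /andP[a0 b0] eqG.
have coefr k : a * (G`_k) ^+ p = b * (('X - u%:P) ^+ r)`_k.
  by have /(congr1 (fun R : {poly F} => R`_k)) := eqG; rewrite !coefZ coef_map.
have Xr : (('X - u%:P) ^+ r)`_r = 1.
  have /monicP : ('X - u%:P) ^+ r \is monic by rewrite monic_exp ?monicXsubC.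
  by rewrite lead_coefE size_exp_XsubC.
have Xr1 : (('X - u%:P) ^+ r)`_r.-1 = - (r%:R * u).
  rewrite addrC -polyCN exprDn coef_sum.
  case: (r) r_gt0 => // s _ /=.
  rewrite (bigD1 (inord s)) //= big1 ?addr0.
    rewrite inordK // subSnn expr1 coefMn coefCM coefXn eqxx mulr1.
    by rewrite binSn mulNrn mulr_natl.
  move=> i ne_is; rewrite -polyC_exp coefMn coefCM coefXn.
  case: eqP => [es|_]; last by rewrite mulr0 mul0rn.
  by case/eqP: ne_is; apply: val_inj; rewrite /= inordK.
have nzr : r%:R != 0 :> F.
  rewrite -(dvdn_pcharf pcharF) gtnNdvd //.
  by rewrite ltn_neqAle ne_rp.
have := coefr r.-1; rewrite Xr1.
have := coefr r; rewrite Xr mulr1 => <-.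
rewrite -mulrA => /(mulfI a0) eqG1.
have nzGr : G`_r != 0 by rewrite -[r]/(r.+1.-1) -szG -lead_coefE lead_coef_eq0.
case/eqP: (u_npow (- (G`_r.-1 / G`_r / r%:R))).
rewrite -[LHS]/(pFrobenius_aut pcharF _) !(rmorphN, fmorph_div) /=.
rewrite rmorph_nat !pFrobenius_autE eqG1 mulrN !mulNr opprK [_ * (_ * u)]mulrC.
by rewrite mulfK ?expf_neq0 // mulrAC divff // mul1r.
Qed.

(** If [Q] does not divide P, the two are coprime, and evaluating a Bezout relation gives 0 = 1. *)
Lemma frob_eval_eq0 (P : {poly F}) : (frob_eval P == 0) = (Q %| P).
Proof.
apply/idP/idP => [P0|/dvdpP[R ->]]; last first.
  by rewrite rmorphM /= frob_eval_Xp_sub mulr0.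
apply: contraLR P0.
rewrite -irreducible_poly_coprime; last exact: irredp_Xp_sub.
case/Bezout_eq1_coprimepP => -[a b] /= eq1.
apply/eqP => P0; have := congr1 frob_eval eq1.
rewrite rmorphD !rmorphM /= frob_eval_Xp_sub P0 !mulr0 addr0 rmorph1.
by move/esym/eqP; rewrite oner_eq0.
Qed.

Hypothesis frob_eval_surj : forall f, exists P, frob_eval P == f.

Definition frob_rep (f : F) : {poly F} := xchoose (frob_eval_surj f).

Lemma frob_repK f : frob_eval (frob_rep f) = f.
Proof. exact/eqP/(xchooseP (frob_eval_surj f)). Qed.

Definition frob_deriv (f : F) : F := frob_eval (frob_rep f)^`().

(* With respect to u, the Cartier operator maps f du to (frob_coef f) du. *)
Definition frob_coef (f : F) : F := (frob_rep f %% Q)`_p.-1.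

Lemma frob_rep_eval P : Q %| frob_rep (frob_eval P) - P.
Proof. by rewrite -frob_eval_eq0 rmorphB /= frob_repK subrr. Qed.

(** Independent of the representative because Q' = 0: adding R Q adds R' Q to the derivative. *)
Lemma frob_deriv_eval P : frob_deriv (frob_eval P) = frob_eval P^`().
Proof.
apply/eqP; rewrite -subr_eq0 -rmorphB -derivB.
have /dvdpP[R ->] := frob_rep_eval P.
by rewrite derivM deriv_Xp_sub mulr0 addr0 rmorphM /= frob_eval_Xp_sub mulr0.
Qed.

Lemma frob_coef_eval P : frob_coef (frob_eval P) = (P %% Q)`_p.-1.
Proof.
apply/eqP; rewrite -subr_eq0 -coefB -modpN -modpD.
by have := frob_rep_eval P; rewrite /dvdp => /eqP ->; rewrite coef0.
Qed.

Lemma frob_derivD f g : frob_deriv (f + g) = frob_deriv f + frob_deriv g.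
Proof.
rewrite -[f]frob_repK -[g]frob_repK -rmorphD !frob_deriv_eval.
by rewrite derivD rmorphD.
Qed.

Lemma frob_derivM f g :
  frob_deriv (f * g) = f * frob_deriv g + g * frob_deriv f.
Proof.
rewrite -[f]frob_repK -[g]frob_repK -rmorphM !frob_deriv_eval.
by rewrite derivM rmorphD !rmorphM /= addrC [frob_eval _^`() * _]mulrC.
Qed.

Lemma frob_deriv_pow f : frob_deriv (f ^+ p) = 0.
Proof. by rewrite -frob_evalC frob_deriv_eval derivC rmorph0. Qed.

Lemma frob_deriv_gen : frob_deriv u = 1.
Proof. by rewrite -frob_evalX frob_deriv_eval derivX rmorph1. Qed.

Lemma frob_derivX f k : frob_deriv (f ^+ k) = k%:R * f ^+ k.-1 * frob_deriv f.
Proof.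
rewrite -[f]frob_repK -rmorphXn !frob_deriv_eval deriv_exp.
rewrite rmorphMn rmorphM rmorphXn /= -mulr_natl -mulrA.
by rewrite [frob_eval _^`() * _]mulrC.
Qed.

Lemma frob_coef_is_zmod_morphism : zmod_morphism frob_coef.
Proof.
move=> f g; rewrite -[f]frob_repK -[g]frob_repK -rmorphB !frob_coef_eval.
by rewrite modpD modpN coefB.
Qed.

HB.instance Definition _ :=
  GRing.isZmodMorphism.Build F F frob_coef frob_coef_is_zmod_morphism.

Lemma frob_coefN f : frob_coef (- f) = - frob_coef f.
Proof. exact: raddfN. Qed.

Lemma frob_coef_sum I (r : seq I) (P : pred I) (f : I -> F) :
  frob_coef (\sum_(i <- r | P i) f i) = \sum_(i <- r | P i) frob_coef (f i).
Proof. exact: raddf_sum. Qed.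

Lemma frob_coefM y f : frob_coef (y ^+ p * f) = y * frob_coef f.
Proof.
rewrite -[f]frob_repK -frob_evalZ !frob_coef_eval modpZl; last by rewrite coefZ.
Qed.

(** As Q' = 0, the representative may be reduced modulo [Q] before differentiating; the derivative
    then has degree below p - 1. *)
Lemma frob_coef_deriv f : frob_coef (frob_deriv f) = 0.
Proof.
rewrite /frob_deriv frob_coef_eval.
rewrite {1}(divp_eq (frob_rep f) Q) derivD derivM deriv_Xp_sub mulr0 addr0.
rewrite modpD modp_mull add0r; set R := frob_rep f %% Q.
have leR : (size R <= p)%N.
  by rewrite -ltnS -size_Xp_sub ltn_modp -size_poly_eq0 size_Xp_sub.
have [->|nzR] := eqVneq R 0; first by rewrite deriv0 mod0p coef0.
have ltR' : (size R^`() <= p.-1)%N.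
  by rewrite -ltnS prednK ?prime_gt0 // (leq_trans (lt_size_deriv nzR)).
rewrite modp_small ?nth_default // size_Xp_sub ltnS.
by rewrite (leq_trans ltR') ?leq_pred.
Qed.

Lemma frob_coefX k r : (r < p)%N ->
  frob_coef (u ^+ (p * k + r)) = if r == p.-1 then u ^+ k else 0.
Proof.
move=> ltr; rewrite exprD mulnC exprM frob_coefM.
rewrite -{2}frob_evalX -rmorphXn frob_coef_eval.
rewrite modp_small ?size_Xp_sub ?size_polyXn // coefXn eq_sym.
by case: eqP; rewrite ?mulr1 ?mulr0.
Qed.

Lemma natr_lt_pchar_neq0 i : (i.+1 < p)%N -> i.+1%:R != 0 :> F.
Proof. by move=> ltip; rewrite -(dvdn_pcharf pcharF) gtnNdvd. Qed.

(* The binomial expansion of ((f + g)^p - f^p - g^p) / p shows that           *)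
(* (f + g)^(p-1) d(f + g) - f^(p-1) df - g^(p-1) dg is exact.                 *)
Lemma frob_coef_logD f g :
  frob_coef ((f + g) ^+ p.-1 * frob_deriv (f + g)) =
  frob_coef (f ^+ p.-1 * frob_deriv f) + frob_coef (g ^+ p.-1 * frob_deriv g).
Proof.
pose s := p.-1; have defp : p = s.+1 by rewrite prednK ?prime_gt0.
rewrite -/s frob_derivD mulrDr [f + g]addrC !exprDn.
rewrite [X in X * frob_deriv f]big_ord_recr.
rewrite [X in X * frob_deriv g]big_ord_recl /=.
rewrite subnn subn0 binn bin0 !expr0 !mul1r !mulr1 !mulr1n !mulrDl.
rewrite [X in frob_coef (X + _)]addrC addrACA raddfD /= raddfD /=.
rewrite [X in _ + X](_ : _ = 0) ?addr0 //.
rewrite !mulr_suml -big_split raddf_sum big1 //= => i _.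
rewrite /bump /= add1n.
have nzi : i.+1%:R != 0 :> F by rewrite natr_lt_pchar_neq0 // defp ltnS.
have defb : 'C(s, i.+1)%:R = (s - i)%:R * 'C(s, i)%:R / i.+1%:R :> F.
  by rewrite -natrM -mul_bin_left natrM mulrC mulKf.
(* The scalar lies in the prime field, so it is its own p-th power and [frob_coefM] pulls it out of
   an exact term. *)
rewrite [X in frob_coef X](_ : _ = ('C(s, i)%:R / i.+1%:R) ^+ p
  * frob_deriv (f ^+ i.+1 * g ^+ (s - i))).
  by rewrite frob_coefM frob_coef_deriv mulr0.
rewrite -[_ ^+ p](pFrobenius_autE pcharF) fmorph_div !rmorph_nat.
rewrite frob_derivM !frob_derivX /= -subnS -[_ *+ 'C(s, i)]mulr_natl.
rewrite -[_ *+ 'C(s, i.+1)]mulr_natl defb.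
move: i.+1%:R nzi (s - i)%:R ('C(s, i)%:R) (f ^+ i.+1) => k nzk l c f'.
by field.
Qed.

Lemma frob_coef_logM f g :
  frob_coef ((f * g) ^+ p.-1 * frob_deriv (f * g)) =
  f * frob_coef (g ^+ p.-1 * frob_deriv g)
  + g * frob_coef (f ^+ p.-1 * frob_deriv f).
Proof.
have p_gt0 := prime_gt0 p_pr.
rewrite -!frob_coefM -raddfD /= frob_derivM exprMn; congr frob_coef.
by rewrite -[in RHS](prednK p_gt0) !exprS /=; ring.
Qed.

(** By [frob_coef_logD] and [frob_coef_logM] the left side is a derivation in f that kills p-th
    powers, so only the value at u has to be compared. *)
Lemma frob_coef_log f : frob_coef (f ^+ p.-1 * frob_deriv f) = frob_deriv f.
Proof.
have p_gt0 := prime_gt0 p_pr.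
rewrite -[f]frob_repK; elim/poly_ind: (frob_rep f) => [|P c IH].
  have /= := frob_deriv_pow 0; rewrite expr0n -[p]prednK //= => D0.
  by rewrite rmorph0 D0 mulr0 raddf0.
rewrite rmorphD rmorphM /= frob_evalX frob_evalC.
rewrite frob_coef_logD frob_derivD frob_deriv_pow mulr0 raddf0 !addr0.
rewrite frob_coef_logM frob_derivM IH frob_deriv_gen mulr1; congr (_ * _ + _).
have -> : (p.-1 = p * 0 + p.-1)%N by rewrite muln0.
by rewrite frob_coefX ?eqxx ?expr0 // prednK.
Qed.

(** Independence of t: for i < p - 1, t^i dt is the differential of t^(i+1) / (i+1), while i = p - 1
    is [frob_coef_log]. *)
Lemma frob_coef_subst t (x : nat -> F) :
  frob_coef ((\sum_(i < p) x i ^+ p * t ^+ i) * frob_deriv t) =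
  x p.-1 * frob_deriv t.
Proof.
have p_gt0 := prime_gt0 p_pr.
rewrite mulr_suml raddf_sum /=.
have ltp : (p.-1 < p)%N by rewrite prednK.
rewrite (bigD1 (Ordinal ltp)) //= [X in _ + X]big1 => [|i nei].
  by rewrite addr0 -mulrA frob_coefM frob_coef_log.
have lti : (i.+1 < p)%N.
  have := ltn_ord i; rewrite leq_eqVlt => /predU1P[ei|//].
  by case/eqP: nei; apply: val_inj; rewrite /= -[LHS]/i.+1.-1 ei.
rewrite -mulrA frob_coefM.
rewrite [_ * _ t](_ : _ = (i.+1%:R^-1) ^+ p * frob_deriv (t ^+ i.+1)).
  by rewrite frob_coefM frob_coef_deriv !mulr0.
rewrite frob_derivX exprVn -[_ ^+ p](pFrobenius_autE pcharF) pFrobenius_aut_nat.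
by rewrite -mulrA mulKf ?natr_lt_pchar_neq0.
Qed.

End FrobeniusEval.

(** * Comparison with the abstract differentials and [cartier] *)

Lemma derivationX (K : fieldType) (F : fieldExtType {fraction {poly K}})
    (M : lmodType F) (D : F -> M) x k :
  is_derivation D -> D (x ^+ k) = (k%:R * x ^+ k.-1) *: D x.
Proof.
case=> _ DM DK; elim: k => [|k IH].
  by rewrite expr0 -(rmorph1 (const F)) DK mul0r scale0r.
rewrite exprS DM IH scalerA -scalerDl; congr (_ *: _).
case: k {IH} => [|k] /=; first by rewrite !mul0r !mulr0 add0r expr0 mulr1.
by rewrite exprS; ring.
Qed.

Section CartierOperator.

Variables (K : fieldType) (F : fieldExtType {fraction {poly K}}) (p : nat).
Variables (pcharF : p \in [pchar F]) (u : F).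
Hypothesis K_perfect : forall c : K, exists b, b ^+ p = c.
Hypothesis u_npow : forall y, y ^+ p != u.
Hypothesis frob_eval_surj : forall f, exists P, frob_eval pcharF u P == f.

Local Notation D := (frob_deriv frob_eval_surj).
Local Notation C := (frob_coef frob_eval_surj).

Lemma frob_deriv_is_derivation : @is_derivation K F F^o D.
Proof.
split=> [||c]; [exact: frob_derivD | exact: frob_derivM|].
by have [b <-] := K_perfect c; rewrite rmorphXn /= frob_deriv_pow.
Qed.

Variables (Omega : lmodType F) (d : F -> Omega) (dP : is_differentials d).

Lemma differential_frob_deriv f : d f = D f *: d u.
Proof.
have [d_der _] := dP; have [dD dM _] := d_der.
rewrite -[f](frob_repK frob_eval_surj); set P := frob_rep _ _.
have dpow c : d (c ^+ p) = 0.
  by rewrite derivationX // (pcharf0 pcharF) mul0r scale0r.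
elim/poly_ind: P => [|P c IH].
  have := dpow 0; have /= := frob_deriv_pow u_npow frob_eval_surj 0.
  rewrite rmorph0 expr0n gtn_eqF ?prime_gt0 //; last by case/andP: pcharF.
  by move=> -> ->; rewrite scale0r.
rewrite rmorphD rmorphM /= frob_evalX frob_evalC dD dM dpow IH addr0.
rewrite frob_derivD // frob_derivM // frob_deriv_pow // addr0.
by rewrite frob_deriv_gen // scalerA -scalerDl mulr1.
Qed.

(** By the universal property, [frob_deriv] factors through [d], and it takes u to 1. *)
Lemma differential_gen_neq0 : d u != 0.
Proof.
have [_ /(_ _ _ frob_deriv_is_derivation)[f Df _]] := dP.
apply/eqP => du0; have := Df u.
by rewrite frob_deriv_gen // du0 linear0 => /eqP; rewrite oner_eq0.
Qed.

Lemma scale_differential_inj f g : f *: d u = g *: d u -> f = g.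
Proof.
move/eqP; rewrite -subr_eq0 -scalerBl scaler_eq0 (negPf differential_gen_neq0).
by rewrite orbF subr_eq0 => /eqP.
Qed.

(** [frob_coef_subst] forces the value of any image; one exists, with t = u and the coefficients of
    the representative modulo X^p - u. *)
Lemma cartier_frob_coef f : separating u ->
  cartier p d (f *: d u) = C f *: d u.
Proof.
move=> sep_u; have p_pr : prime p by case/andP: pcharF.
rewrite /cartier; case: xgetP => [v _ | none].
  case=> t [x [_ defw ->]].
  move: defw; rewrite (differential_frob_deriv t) !scalerA.
  move=> /scale_differential_inj ->.
  by rewrite frob_coef_subst.
pose R := frob_rep frob_eval_surj f %% ('X^p - u%:P).
have leR : (size R <= p)%N.
  by rewrite -ltnS -(size_Xp_sub pcharF u) ltn_modp -size_poly_eq0 size_Xp_sub.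
case: (none (C f *: d u)); exists u, (nth 0 R); split=> //.
congr (_ *: _); rewrite -(frob_evalE pcharF u leR).
rewrite -{1}[f](frob_repK frob_eval_surj).
rewrite {1}(divp_eq (frob_rep _ _) ('X^p - u%:P)).
by rewrite rmorphD rmorphM /= frob_eval_Xp_sub mulr0 add0r.
Qed.

End CartierOperator.

(** * The subfield K(U) and separability *)

Section RationalSubfield.

Variables (K : fieldType) (F : fieldExtType {fraction {poly K}}).
Local Notation U := (ratvar F).

Lemma fracP (a : {fraction {poly K}}) :
  exists2 b : {poly K} * {poly K}, b.2 != 0 & a = tofrac b.1 / tofrac b.2.
Proof.
elim/quotW: a => r; exists (frac r); first exact: denom_ratioP.
apply: (canRL (mulfK _)); first by rewrite tofrac_eq0 denom_ratioP.
unlock FracField.tofrac; rewrite -[LHS]FracField.pi_mul.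
apply/eqmodP; rewrite /= FracField.equivfE /FracField.mulf.
rewrite !numden_Ratio ?mulr1 ?oner_eq0 ?denom_ratioP //.
by rewrite mulrC.
Qed.

Lemma peval_ratvar (a : {poly K}) : peval U a = (tofrac a)%:A.
Proof.
rewrite /peval; elim/poly_ind: a => [|P c IH].
  by rewrite rmorph0 horner0 rmorph0 scale0r.
rewrite !rmorphD !rmorphM /= map_polyX map_polyC !hornerE IH /ratvar -!in_algE.
by rewrite -rmorphM -rmorphD.
Qed.

Lemma ratfun_in_adjoin (a : {fraction {poly K}}) : in_adjoin U a%:A.
Proof.
have [[x y] /= nzy ->] := fracP a.
exists x, y; rewrite !peval_ratvar; split.
  by rewrite scaler_eq0 oner_eq0 orbF tofrac_eq0.
by rewrite -!in_algE fmorph_div.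
Qed.

Lemma ratvar_neq0 : U != 0.
Proof. by rewrite scaler_eq0 oner_eq0 orbF tofrac_eq0 polyX_eq0. Qed.

Lemma separating_ratvar :
  (forall x : F, separable_element 1 x) -> separating U.
Proof.
move=> sepF x; exists (minPoly 1%VS x); split.
- by move=> i; have /polyOverP/(_ i)/vlineP[a ->] := minPolyOver 1 x;
    apply: ratfun_in_adjoin.
- exact: sepF.
- exact: root_minPoly.
Qed.

(** A separable y lies in K(U)(y^p), which is K(U) if y^p = U. Writing y = x / z gives x^p = U z^p,
    whose degrees differ modulo p. *)
Lemma ratvar_npow p y : p \in [pchar F] -> separable_element 1 y -> y ^+ p != U.
Proof.
move=> pcharF sep_y; apply/eqP => yp.
have : y \in 1%VS.
  move: sep_y; rewrite (@pcharf_p_separable _ _ 1%AS y 0 p) // expn1 yp.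
  suff U1 : U \in 1%AS by rewrite (Fadjoin_idP U1).
  exact: rpredZ (rpred1 _).
case/vlineP => a defy; move: yp; rewrite defy.
have [[x z] /= nzz ->] := fracP a => {a defy}.
have p_gt1 : (1 < p)%N by case/andP: pcharF => /prime_gt1.
have nzt : tofrac z ^+ p != 0 by rewrite expf_neq0 // tofrac_eq0.
rewrite /ratvar -!in_algE -rmorphXn => /fmorph_inj; rewrite expr_div_n.
move/(canRL (mulfVK nzt)); rewrite -!rmorphXn -rmorphM => /eqP.
rewrite tofrac_eq => /eqP eqx.
have nzz' : z ^+ p != 0 by rewrite expf_neq0.
have := congr1 (fun a : {poly K} => (size a).-1) eqx.
rewrite size_exp mulrC size_mulX //=.
rewrite -(prednK (n := size (z ^+ p))) ?size_poly_gt0 //.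
rewrite size_exp => /(congr1 (modn^~ p)).
by rewrite -addn1 modnMDl modnMl modn_small.
Qed.

End RationalSubfield.

(** * Ceilings, congruences, binomial coefficients and a separability criterion *)

Lemma leq_ceil_div a b : (0 < b)%N -> (a <= b * ceil_div a b)%N.
Proof.
move=> b_gt0; rewrite /ceil_div; have := ltn_ceil (a + b.-1) b_gt0.
rewrite mulSn mulnC; lia.
Qed.

Lemma ltn_ceil_div a b : (0 < b)%N -> (b * ceil_div a b < a + b)%N.
Proof.
move=> b_gt0; rewrite /ceil_div; have := leq_divM (a + b.-1) b.
rewrite mulnC; lia.
Qed.

(* If r s = p l + 1 and a < r, then no integer lies in [a l / r, a s / p), so  *)
(* the two numbers have the same ceiling.                                      *)
Lemma ceil_div_bounds p l r s a (c := ceil_div (a * l) r) :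
  (0 < p)%N -> (r * s = p * l + 1)%N -> (a < r)%N ->
  (s * a <= p * c < s * a + p)%N.
Proof.
move=> p_gt0 rs lt_ar; have r_gt0 : (0 < r)%N by apply: leq_trans lt_ar.
have := leq_ceil_div (a * l) r_gt0; have := ltn_ceil_div (a * l) r_gt0.
rewrite -/c => c_lt c_ge; apply/andP; split.
- rewrite leqNgt; apply/negP => lt_c.
  have : (r * (p * c).+1 <= r * s * a)%N by rewrite -mulnA leq_mul2l lt_c orbT.
  have : (p * (a * l) <= p * (r * c))%N by rewrite leq_mul2l c_ge orbT.
  rewrite rs; nia.
- rewrite -(ltn_pmul2l r_gt0).
  have : (p * (r * c) < p * (a * l + r))%N by rewrite ltn_pmul2l.
  have -> : (r * (s * a + p) = (p * l + 1) * a + r * p)%N by rewrite -rs; ring.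
  nia.
Qed.

(** This is p (r c - a l) = a + r (p c - s a), from p l = r s - 1; it yields the exponents [it] and
    [jt]. *)
Lemma ceil_div_exponent p l r s a (c := ceil_div (a * l) r) :
  (0 < r)%N -> (r * s = p * l + 1)%N ->
  (p * (r * c - a * l) + r * (s * a) = r * (p * c) + a)%N.
Proof.
move=> r_gt0 rs; rewrite mulnBr [(r * (p * c))%N]mulnCA.
have -> : (r * (s * a) = p * (a * l) + a)%N.
  by rewrite mulnA rs mulnDl mul1n mulnAC -mulnA.
by rewrite addnA subnK // leq_mul2l leq_ceil_div ?orbT.
Qed.

Lemma eq_of_modM p n l k : coprime p n -> (l < p)%N -> (k < p)%N ->
  n * l == n * k %[mod p] -> l = k.
Proof.
move=> co_pn; wlog le_lk : l k / (l <= k)%N => [W lt_lp lt_kp eq_lk|].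
  case: (leqP l k) => [|/ltnW] le; first exact: W.
  by apply/esym; apply: W => //; rewrite eq_sym.
move=> _ lt_kp; rewrite eq_sym eqn_mod_dvd ?leq_mul2l ?le_lk ?orbT //.
rewrite -mulnBr Gauss_dvdr // => dvd_kl; apply/eqP; rewrite eqn_leq le_lk /=.
rewrite -subn_eq0; case: posnP => // kl_gt0.
by have := dvdn_leq kl_gt0 dvd_kl; lia.
Qed.

Lemma bin_natr_eq0 (R : nzRingType) p a k : p \in [pchar R] -> (a < p)%N ->
  ('C(a, k)%:R == 0 :> R) = (a < k)%N.
Proof.
move=> pcharR lt_ap; have p_pr : prime p by case/andP: pcharR.
rewrite -(dvdn_pcharf pcharR); case: (ltnP a k) => [lt_ak|le_ka].
  by rewrite bin_small ?dvdn0.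
apply: contraTF lt_ap => dvd_bin; rewrite -leqNgt.
have : (p %| a`!)%N by rewrite -(bin_fact le_ka) dvdn_mulr.
elim: (a) => [|b IH]; first by rewrite Euclid_dvd1.
rewrite factS Euclid_dvdM // => /orP[/dvdn_leq -> //|/IH]; exact: leqW.
Qed.

(** The derivative k X^(k-1) of X^k - x^k vanishes at most at 0, which is not a root of X^k -
    x^k. *)
Lemma separable_root_base (F0 : fieldType) (L : fieldExtType F0)
    (E : {subfield L}) (x : L) k :
  x != 0 -> k%:R != 0 :> L -> x ^+ k \in E -> separable_element E x.
Proof.
move=> x0 k0 Ek; apply/separable_elementP; exists ('X^k - (x ^+ k)%:P); split.
- by rewrite rpredB ?polyOverXn ?polyOverC.
- by rewrite /root hornerD hornerN hornerXn hornerC subrr.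
have k_gt0 : (0 < k)%N by case: k k0 {Ek}; rewrite ?eqxx.
rewrite unlock derivB derivC subr0 derivXn -scaler_nat coprimepZr //.
rewrite coprimep_expr // coprimepX rootE hornerD hornerN hornerXn hornerC.
by rewrite expr0n gtn_eqF // add0r oppr_eq0 expf_neq0.
Qed.

(** * The curve U^n + V^m + 1 = 0 *)

Section FermatCurve.

Variables (p : nat) (K : finFieldType) (N : nat).
Hypotheses (p_pr : prime p) (N_gt0 : (0 < N)%N) (cardK : #|K| = (p ^ N)%N).
Variables (F : fieldExtType {fraction {poly K}}) (V : F) (n m q' : nat).
Hypotheses (n_gt0 : (0 < n)%N) (m_gt0 : (0 < m)%N).
Hypotheses (F_gen : <<1; V>>%VS = fullv)
           (UV_eq : ratvar F ^+ n + V ^+ m + 1 = 0).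
Variable s : nat.
Hypothesis ms : (m * s = p * q' + 1)%N.

Local Notation U := (ratvar F).

Lemma pchar_fermat : p \in [pchar F].
Proof. exact: (rmorph_pchar (const F)) (card_finPcharP cardK p_pr). Qed.

Lemma finField_perfect (c : K) : exists b, b ^+ p = c.
Proof.
exists (c ^+ (p ^ N.-1)).
by rewrite -exprM -expnSr (prednK N_gt0) -cardK expf_card.
Qed.

Lemma expVm : V ^+ m = - (1 + U ^+ n).
Proof. by rewrite -[LHS]subr0 -UV_eq; ring. Qed.

Lemma fermat_neq0 : 1 + U ^+ n != 0.
Proof.
rewrite addrC /ratvar -in_algE -rmorphXn -(rmorph1 (in_alg F)) -rmorphD.
rewrite fmorph_eq0 -rmorphXn -(rmorph1 (@tofrac _)) -rmorphD tofrac_eq0.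
by rewrite -size_poly_eq0 size_XnaddC.
Qed.

Lemma V_neq0 : V != 0.
Proof.
apply: contraNneq fermat_neq0 => V0; have := expVm.
by rewrite V0 expr0n gtn_eqF // => /esym/eqP; rewrite oppr_eq0.
Qed.

Lemma natm_neq0 : m%:R != 0 :> F.
Proof.
rewrite -(dvdn_pcharf pchar_fermat); apply/negP => /(dvdn_mulr s).
by rewrite ms dvdn_addr ?dvdn_mulr // Euclid_dvd1.
Qed.

Lemma fermat_separable (x : F) : separable_element 1%AS x.
Proof.
have sepV : separable_element 1%AS V.
  apply: separable_root_base (V_neq0) natm_neq0 _.
  rewrite expVm rpredN rpredD ?rpred1 // rpredX //.
  exact: rpredZ (rpred1 _).
have /adjoin_separableP := sepV; apply.
by rewrite F_gen memvf.
Qed.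

Lemma fermat_npow (y : F) : y ^+ p != U.
Proof. exact: ratvar_npow pchar_fermat (fermat_separable y). Qed.

(* V = V^(p q' + 1) / V^(p q'), where V^(p q' + 1) = (V^m)^s lies in K[U]. *)
Lemma fermat_frob_eval_surj (f : F) : exists P, frob_eval pchar_fermat U P == f.
Proof.
pose S f := exists P, frob_eval pchar_fermat U P = f.
suff [P <-] : S f by exists P.
have S1 : S 1 by exists 1; rewrite rmorph1.
have SD g h : S g -> S h -> S (g + h).
  by case=> P <- [R <-]; exists (P + R); rewrite rmorphD.
have SM g h : S g -> S h -> S (g * h).
  by case=> P <- [R <-]; exists (P * R); rewrite rmorphM.
have SN g : S g -> S (- g) by case=> P <-; exists (- P); rewrite rmorphN.
have SX g k : S g -> S (g ^+ k).
  by case=> P <-; exists (P ^+ k); rewrite rmorphXn.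
have SV g : S g -> S g^-1.
  case=> P /frob_eval_inv defg; exact: ex_intro defg.
have Sp g : S (g ^+ p) by exists g%:P; rewrite frob_evalC.
have SU : S U by exists 'X; rewrite frob_evalX.
have Sconst c : S (const F c).
  by have [b <-] := finField_perfect c; rewrite rmorphXn; apply: Sp.
have Speval (a : {poly K}) : S (peval U a).
  rewrite /peval; elim/poly_ind: a => [|a c IH].
    by rewrite rmorph0 horner0; have := Sconst 0; rewrite rmorph0.
  rewrite rmorphD rmorphM /= map_polyX map_polyC !hornerE.
  by apply: SD (Sconst c); apply: SM.
have SK (a : {fraction {poly K}}) : S a%:A.
  have [x [y [_ ->]]] := ratfun_in_adjoin F a.
  by apply: SM (SV _ _).
have SVV : S V.
  have -> : V = V ^+ m ^+ s * (V ^- q') ^+ p.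
    by rewrite -exprM ms exprVn -exprM mulnC exprD expr1 mulrAC divff ?mul1r
               ?expf_neq0 ?V_neq0.
  by rewrite expVm; apply: SM (Sp _); apply/SX/SN/SD/SX.
have /Fadjoin1_polyP[P ->] : f \in <<1; V>>%VS by rewrite F_gen memvf.
elim/poly_ind: P => [|P c IH]; first by rewrite rmorph0 horner0 -(scale0r 1).
rewrite rmorphD rmorphM /= map_polyX map_polyC !hornerE.
by apply: SD (SK c); apply: SM.
Qed.

Local Notation C := (frob_coef fermat_frob_eval_surj).

Lemma frob_coef_nat k f : C (k%:R * f) = k%:R * C f.
Proof.
rewrite -[in LHS](pFrobenius_aut_nat pchar_fermat) pFrobenius_autE.
exact: (frob_coefM fermat_npow).
Qed.

Lemma frob_coef_sign k f : C ((-1) ^+ k * f) = (-1) ^+ k * C f.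
Proof.
rewrite -signr_odd !mulr_sign; case: odd => //.
exact: (frob_coefN fermat_npow).
Qed.

(** The predecessors come from writing the differential as U^k dU / U: it survives when p divides k,
    and k becomes k / p. *)
Lemma frob_coefX_pred k : (0 < k)%N ->
  C (U ^+ k.-1) = if (p %| k)%N then U ^+ (k %/ p).-1 else 0.
Proof.
move=> k_gt0; have p_gt0 := prime_gt0 p_pr.
rewrite (divn_eq k.-1 p) mulnC frob_coefX ?ltn_mod //; last exact: fermat_npow.
have -> : (k.-1 %% p == p.-1)%N = (p %| k)%N.
  rewrite -{2}(prednK k_gt0) {2}(divn_eq k.-1 p) -addnS dvdn_addr ?dvdn_mull //.
  move: (k.-1 %% p)%N (ltn_pmod k.-1 p_gt0) => t lt_tp.
  apply/eqP/idP => [->|/(dvdn_leq (ltn0Sn _))]; first by rewrite prednK.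
  by move: lt_tp; clear; lia.
case: ifP => // /dvdnP[r defk].
have r_gt0 : (0 < r)%N by case: r defk k_gt0 => // ->.
have -> : k.-1 = (r.-1 * p + p.-1)%N by rewrite defk -{1}(prednK r_gt0); lia.
by rewrite divnMDl // divn_small ?addn0 ?defk ?mulnK // prednK.
Qed.

(* Collecting p-th powers, V^(j - m) = (V^b / V^m)^p (- (1 + U^n))^a. The     *)
(* Cartier operator keeps only the terms U^(nk + i - 1) of the expansion with *)
(* p dividing nk + i.                                                         *)
Lemma frob_coef_omega i j a b k c :
  (0 < i)%N -> (p * b + m * a + m = j + p * m)%N -> 
  (k < p)%N -> (a < p)%N -> coprime p n -> (p * c = i + n * k)%N ->
  C (U ^+ i * V ^+ j / (U * V * (m%:R * V ^+ m.-1))) =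
  (-1) ^+ a * 'C(a, k)%:R * (U ^+ c * V ^+ b / (U * V * (m%:R * V ^+ m.-1))).
Proof.
move=> i_gt0 eqV lt_kp lt_ap co_pn eqU.
have U0 := ratvar_neq0 F; have V0 := V_neq0; have m0 := natm_neq0.
have c_gt0 : (0 < c)%N by case: c eqU i_gt0 => //; lia.
have reduce x y : (0 < x)%N ->
    U ^+ x * V ^+ y / (U * V * (m%:R * V ^+ m.-1)) =
    U ^+ x.-1 * (V ^+ y / (m%:R * V ^+ m)).
  have -> : V ^+ m = V * V ^+ m.-1 by rewrite -exprS prednK.
  case: x => // x _; rewrite exprS /=.
  by field; rewrite ?U0 ?V0 ?m0 ?expf_neq0.
rewrite !reduce //.
have -> : U ^+ i.-1 * (V ^+ j / (m%:R * V ^+ m)) =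
    (V ^+ b / (m%:R * V ^+ m)) ^+ p * (V ^+ m ^+ a * U ^+ i.-1).
  have mp : m%:R ^+ p = m%:R :> F.
    by rewrite -(pFrobenius_autE pchar_fermat) pFrobenius_aut_nat.
  rewrite expr_div_n exprMn mp -!exprM.
  have -> : V ^+ j = V ^+ (b * p) * V ^+ (m * a) * V ^+ m / V ^+ (m * p).
    apply: (canRL (mulfK _)); rewrite ?expf_neq0 // -!exprD.
    by congr (_ ^+ _); lia.
  move: (V ^+ m) (V ^+ (m * p)) (expf_neq0 m V0) (expf_neq0 (m * p) V0).
  move: (V ^+ (b * p)) (V ^+ (m * a)) (U ^+ i.-1) => x y z vm vmp vm0 vmp0.
  by move: m%:R m0 => M M0; field; rewrite vmp0 M0 vm0.
rewrite (frob_coefM fermat_npow).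
move: (V ^+ b / _) => W.
rewrite expVm [(- (_ + _)) ^+ a]exprNn -[_ * U ^+ i.-1]mulrA frob_coef_sign.
rewrite exprDn mulr_suml (frob_coef_sum fermat_npow) /=.
(* The residues of n l + i modulo p are distinct for l < p, so only l = k contributes. If k > a, no
   index qualifies and binom(a, k) = 0. *)
rewrite (eq_bigr (fun l : 'I_a.+1 =>
  if (l == k :> nat) then 'C(a, k)%:R * U ^+ c.-1 else 0)) => [|l _]; last first.
  rewrite expr1n mul1r -mulr_natl -mulrA frob_coef_nat -exprM -exprD.
  have -> : (n * l + i.-1 = (n * l + i).-1)%N by lia.
  rewrite frob_coefX_pred; last by lia.
  case: eqP => [->|ne_lk].
    by rewrite addnC -eqU dvdn_mulr // mulKn ?prime_gt0.
  case: ifP => [dvd_l|_]; last by rewrite mulr0.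
  have dvd_k : (p %| n * k + i)%N by rewrite addnC -eqU dvdn_mulr.
  case: ne_lk; apply: (eq_of_modM co_pn (leq_trans (ltn_ord l) lt_ap) lt_kp).
  by rewrite -(eqn_modDr i) (eqP dvd_l) (eqP dvd_k).
rewrite -big_mkcond /=.
have -> : \sum_(l < a.+1 | l == k :> nat) 'C(a, k)%:R * U ^+ c.-1 =
    'C(a, k)%:R * U ^+ c.-1.
  have [le_ka|lt_ak] := leqP k a.
    rewrite (big_pred1 (inord k)) // => l.
    by rewrite /= -[RHS](inj_eq val_inj) /= inordK.
  by rewrite bin_small // mul0r big1.
by rewrite mulrC -!mulrA; do 2! congr (_ * _); rewrite mulrC mulrA.
Qed.

Variables (Omega : lmodType F) (d : F -> Omega) (dP : is_differentials d).

Lemma cartier_omega i j a b k c :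
  (0 < i)%N -> (p * b + m * a + m = j + p * m)%N ->
  (k < p)%N -> (a < p)%N -> coprime p n -> (p * c = i + n * k)%N ->
  cartier p d (omega d m U V i j) =
  ((-1) ^+ a * 'C(a, k)%:R) *: omega d m U V c b.
Proof.
move=> i_gt0 eqV lt_kp lt_ap co_pn eqU; rewrite /omega scalerA.
rewrite -(frob_coef_omega i_gt0 eqV lt_kp lt_ap co_pn eqU).
apply: cartier_frob_coef => //; first exact: finField_perfect.
  exact: fermat_npow.
exact/separating_ratvar/fermat_separable.
Qed.

Lemma omega_neq0 i j : omega d m U V i j != 0.
Proof.
have := differential_gen_neq0 finField_perfect fermat_npow
  fermat_frob_eval_surj dP.
rewrite /omega scaler_eq0 negb_or => ->; rewrite andbT.
by rewrite !(mulf_neq0, invr_neq0, expf_neq0, ratvar_neq0, V_neq0, natm_neq0).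
Qed.

End FermatCurve.

(** * Residues read off from the next multiple of p *)

Lemma residueP (x : int) (b r k l : nat) :
  (r < b)%N -> x + (k * b)%:Z = (r + l * b)%:Z -> residue x b = r.
Proof.
move=> lt_rb eqx; rewrite /residue.
have -> : x = r%:Z + (l%:Z - k%:Z) * b%:Z.
  by apply: (addIr (k * b)%:Z); rewrite eqx !PoszD !PoszM; ring.
by rewrite addrC modzMDl modz_small // ltz_nat lt_rb.
Qed.

Section ResidueFromMultiple.

Variables (p x k c : nat).
Hypotheses (lt_kp : (k < p)%N) (kx : (k + x = p * c)%N).

Lemma dvdn_from_multiple : (p %| x)%N = (k == 0)%N.
Proof.
by rewrite -(@dvdn_add_eq p k) ?kx ?dvdn_mulr // /dvdn modn_small.
Qed.

Lemma modn_from_multiple : (0 < k)%N -> (x %% p = p - k)%N.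
Proof.
move=> k_gt0; have c_gt0 : (0 < c)%N by case: c kx => //; lia.
have -> : (x = c.-1 * p + (p - k))%N.
  apply: (@addnI k); rewrite kx addnCA subnKC 1?ltnW //.
  by rewrite addnC -mulSn prednK // mulnC.
by rewrite modnMDl modn_small // ltn_subrL k_gt0 (leq_ltn_trans _ lt_kp).
Qed.

Lemma residue_sub_from_multiple : residue (p%:Z - x%:Z) p = k.
Proof. by apply: (@residueP _ _ _ c 1 lt_kp); rewrite [(c * p)%N]mulnC; lia. Qed.

Lemma residue_pred_from_multiple : residue (x%:Z - 1) p = (p.-1 - k)%N.
Proof.
have lt_p : (p.-1 - k < p)%N by lia.
by apply: (@residueP _ _ _ 1 c lt_p); rewrite [(c * p)%N]mulnC; lia.
Qed.

(** For odd p, p - 1 - k has the parity of k, and k + x = p c has that of c. *)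
Lemma odd_from_multiple : odd p -> odd (p.-1 - k) = odd (c + x).
Proof.
move=> odd_p; have p_gt0 : (0 < p)%N by apply: leq_ltn_trans lt_kp.
have le_kp : (k <= p.-1)%N by rewrite -ltnS prednK.
have := congr1 odd kx; rewrite !oddD oddM odd_p oddB // -subn1 oddB // odd_p /=.
by case: (odd k); case: (odd x); case: (odd c).
Qed.

End ResidueFromMultiple.

(** For nonzero k and b the residues are p - k and p - b, with sum at most p exactly when k + b >=
    p. If one of them is 0, then k + b < p and both sides are false. *)
Lemma modn_sum_from_multiples p x y k b c c' :
  (k < p)%N -> (b < p)%N -> (k + x = p * c)%N -> (b + y = p * c')%N ->
  (p.-1 - b < k)%N =
  [&& ~~ (p %| x)%N, ~~ (p %| y)%N & (x %% p + y %% p <= p)%N].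
Proof.
move=> lt_kp lt_bp kx by_.
rewrite (dvdn_from_multiple lt_kp kx) (dvdn_from_multiple lt_bp by_).
have := modn_from_multiple lt_kp kx; have := modn_from_multiple lt_bp by_.
move: (x %% p)%N (y %% p)%N => x' y'; move: lt_kp lt_bp; clear.
case: k => [|k]; first by rewrite ltn0.
case: b => [|b]; first by rewrite subn0 /=; lia.
by move=> lt_kp lt_bp /(_ isT) -> /(_ isT) -> /=; lia.
Qed.

Theorem corollary3p5
  (p e q n m : nat) (p_prime : prime p) (e_ge1 : (1 <= e)%N)
  (q_def : q = (p ^ e)%N)
  (n_gt0 : (0 < n)%N) (m_gt0 : (0 < m)%N)
  (n_dvd : (n %| q + 1)%N) (m_dvd : (m %| q + 1)%N)
  (K : finFieldType) (cardK : #|K| = (q ^ 2)%N)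
  (F : fieldExtType {fraction {poly K}}) (V : F)
  (F_gen : <<1; V>>%VS = fullv)
  (UV_eq : ratvar F ^+ n + V ^+ m + 1 = 0)
  (Omega : lmodType F) (d : F -> Omega) (dP : is_differentials d)
  (i j : nat) (i_gt0 : (0 < i)%N) (j_gt0 : (0 < j)%N)
  (ij_lt : (m * i + n * j < m * n)%N) :
  let nt := ((q + 1) %/ n)%N in
  let mt := ((q + 1) %/ m)%N in
  let C := cartier p d in
  let w := omega d m (ratvar F) V in
  let it := (n * ceil_div (i * p ^ (e - 1)) n - i * p ^ (e - 1))%N in
  let jt := (m * ceil_div (j * p ^ (e - 1)) m - j * p ^ (e - 1))%N in
  let vanishing := [/\ i <> 0 %[mod p], j <> 0 %[mod p]
                     & ((nt * i) %% p + (mt * j) %% p <= p)%N] in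
  (C (w i j) = 0 <-> vanishing) /\
  (~ vanishing ->
     C (w i j) =
       ((-1) ^+ (ceil_div (j * p ^ (e - 1)) m + mt * j)
        * 'C(residue ((mt * j)%:Z - 1) p,
             residue (p%:Z - (nt * i)%:Z) p)%:R) *: w it jt).

Proof.
move=> nt mt C w it jt vanishing.
have p_gt0 := prime_gt0 p_prime.
pose l := (p ^ (e - 1))%N.
have ql : q = (p * l)%N by rewrite q_def /l -expnS subn1 prednK.
have nnt : (n * nt = p * l + 1)%N by rewrite mulnC divnK // ql.
have mmt : (m * mt = p * l + 1)%N by rewrite mulnC divnK // ql.
have lt_in : (i < n)%N.
  by rewrite -(ltn_pmul2l m_gt0); apply: leq_ltn_trans ij_lt; rewrite leq_addr.
have lt_jm : (j < m)%N.
  rewrite -(ltn_pmul2l n_gt0) [(n * m)%N]mulnC.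
  by apply: leq_ltn_trans ij_lt; rewrite leq_addl.
pose ci := ceil_div (i * l) n; pose cj := ceil_div (j * l) m.
have /andP[ci_ge ci_lt] := ceil_div_bounds p_gt0 nnt lt_in.
have /andP[cj_ge cj_lt] := ceil_div_bounds p_gt0 mmt lt_jm.
rewrite -/ci -/cj in ci_ge ci_lt cj_ge cj_lt.
(* The bounds make [ci] and [cj] the ceilings of nt i / p and mt j / p, so k and b are residues
   modulo p. *)
pose k := (p * ci - nt * i)%N; pose b := (p * cj - mt * j)%N.
have lt_kp : (k < p)%N by rewrite ltn_subLR.
have lt_bp : (b < p)%N by rewrite ltn_subLR.
have k_eq : (k + nt * i = p * ci)%N by rewrite subnK.
have b_eq : (b + mt * j = p * cj)%N by rewrite subnK.
have lt_ap : (p.-1 - b < p)%N.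
  by rewrite (leq_ltn_trans (leq_subr _ _)) // prednK.
have coprime_p x y : (x * y = p * l + 1)%N -> coprime p x.
  move=> xy; rewrite prime_coprime //; apply/negP => /(dvdn_mulr y).
  by rewrite xy dvdn_addr ?dvdn_mulr // Euclid_dvd1.
have eqU : (p * it = i + n * k)%N.
  have := ceil_div_exponent i n_gt0 nnt; have := congr1 (muln n) k_eq.
  rewrite mulnDr -/l -/ci -/it.
  move: (n * k)%N (n * (nt * i))%N (n * (p * ci))%N (p * it)%N.
  by clear; lia.
have eqV : (p * jt + m * (p.-1 - b) + m = j + p * m)%N.
  have := ceil_div_exponent j m_gt0 mmt; have := congr1 (muln m) b_eq.
  have : (m * (p.-1 - b) + m + m * b = p * m)%N.
    rewrite -mulnSr -mulnDr [RHS]mulnC; congr (_ * _)%N.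
    by move: lt_bp; clear; lia.
  rewrite mulnDr -/l -/cj -/jt.
  move: (m * (_ - b))%N (m * (mt * j))%N (m * (p * cj))%N (p * jt)%N.
  by move: (m * b)%N (p * m)%N; clear; lia.
have cardKp : #|K| = (p ^ (e * 2))%N by rewrite cardK q_def expnM.
have N_gt0 : (0 < e * 2)%N by rewrite muln_gt0 e_ge1.
have pcharF : p \in [pchar F] by exact: (pchar_fermat p_prime cardKp).
have Cw : C (w i j) = ((-1) ^+ (p.-1 - b) * 'C(p.-1 - b, k)%:R) *: w it jt.
  exact: (cartier_omega p_prime N_gt0 cardKp n_gt0 m_gt0 F_gen UV_eq mmt dP
    i_gt0 eqV lt_kp lt_ap (coprime_p _ _ nnt) eqU).
have vanishingP : (p.-1 - b < k)%N <-> vanishing.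
  have nmodP x : x <> 0 %[mod p] <-> ~~ (p %| x)%N.
    by rewrite mod0n /dvdn; split => /eqP.
  rewrite (modn_sum_from_multiples lt_kp lt_bp k_eq b_eq).
  rewrite (Gauss_dvdr i (coprime_p _ _ (etrans (mulnC nt n) nnt))).
  rewrite (Gauss_dvdr j (coprime_p _ _ (etrans (mulnC mt m) mmt))).
  by split => [/and3P[/nmodP ? /nmodP ?]|[/nmodP -> /nmodP ->]].
have w_neq0 : w it jt != 0.
  exact: (omega_neq0 p_prime N_gt0 cardKp n_gt0 m_gt0 F_gen UV_eq mmt dP).
have Cw0 : (C (w i j) == 0) = (p.-1 - b < k)%N.
  rewrite Cw scaler_eq0 (negPf w_neq0) orbF mulf_eq0 signr_eq0.
  exact: (bin_natr_eq0 k pcharF lt_ap).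
split; first by rewrite -vanishingP -Cw0; split => /eqP.
move=> _; rewrite Cw (residue_sub_from_multiple lt_kp k_eq).
rewrite (residue_pred_from_multiple lt_bp b_eq); congr (_ * _ *: _).
(* In characteristic 2 both signs are 1; for odd p the two exponents have the same parity. *)
case: (even_prime p_prime) => [p2|odd_p].
  have pchar2 : 2 \in [pchar F] by have := pcharF; rewrite {1}p2.
  by rewrite (oppr_pchar2 pchar2) !expr1n.
by rewrite -signr_odd (odd_from_multiple lt_bp b_eq odd_p) signr_odd.
Qed.
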